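(* Let $\{S_j\}_{j=1}^N$ be an iterated function system of contractive similitudes on $\mathbb R^d$ with self-similar set $K$, let $\kappa>0$, and let $(X^\sim,\mathcal E)$ be the quotient graph of the augmented tree induced by $\{S_j\}_{j=1}^N$, obtained by identifying words $x,y$ with $|x|=|y|$ and $S_x=S_y$. Then $(X^\sim,\mathcal E)$ is of bounded degree if and only if $\{S_j\}_{j=1}^N$ satisfies the weak separation condition.
   Context: $K$ is the unique nonempty compact set with $K=\bigcup_{j=1}^N S_j(K)$. Let $r_j\in(0,1)$ be the contraction ratio of $S_j$ and $r=\min\{r_1,\dots,r_N\}$. $\Sigma^*=\bigcup_{n\ge0}\{1,\dots,N\}^n$ is the set of finite words, $\vartheta$ the empty word; for $x=i_1\cdots i_k\in\Sigma^*$, $S_x=S_{i_1}\circ\cdots\circ S_{i_k}$ ($S_\vartheta=\mathrm{id}$), $r_x=r_{i_1}\cdots r_{i_k}$ ($r_\vartheta=1$), $K_x=S_x(K)$. Let $\mathcal J_0=\{\vartheta\}$ and, for $n\ge1$, $\mathcal J_n=\{i_1\cdots i_k\in\Sigma^*: r_{i_1\cdots i_k}\le r^n<r_{i_1\cdots i_{k-1}}\}$; $X=\bigcup_{n\ge0}\mathcal J_n$, and $|x|=n$ for $x\in\mathcal J_n$. For $x\in\mathcal J_n$, $n\ge1$, let $x^{-1}$ be the initial segment of $x$ that lies in $\mathcal J_{n-1}$. On $X$, the vertical edges are the pairs $(x,x^{-1}),(x^{-1},x)$, $x\in X\setminus\{\vartheta\}$, and, for a fixed $\kappa>0$, the horizontal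 edges are the pairs $(x,y)$ with $|x|=|y|$, $x\neq y$, $\mathrm{dist}(K_x,K_y)\le\kappa r^{|x|}$, where $\mathrm{dist}(E,F)=\inf\{|a-b|:a\in E,b\in F\}$. Quotient graph: $X^\sim$ is the set of equivalence classes of $X$ under the relation $x\sim y$ iff $|x|=|y|$ and $S_x=S_y$; the level $|\cdot|$, the maps $S_x$ and the sets $K_x$ are well defined on classes. $\mathcal E=\mathcal E_v\cup\mathcal E_h$ is the induced edge set on $X^\sim$: two distinct classes are joined by a vertical (resp. horizontal) edge iff they have representatives in $X$ joined by a vertical (resp. horizontal) edge; thus horizontal edges join distinct classes of the same level $n$ with $\mathrm{dist}(K_x,K_y)\le\kappa r^n$. A graph is of bounded degree if the supremum over vertices $x$ of $\deg(x)=\#\{y:(x,y)\in\mathcal E\}$ is finite. $\{S_j\}_{j=1}^N$ satisfies the weak separation condition (WSC) if for any $c>0$ there exists a constant $\gamma=\gamma(c)$ such that for any integer $n>0$ and any $D\subset\mathbb R^d$ with diameter $|D|\le cr^n$, $$\#\{S_x:\ x\in\mathcal J_n,\ S_x(K)\cap D\ne\emptyset\}\le\gamma$$ (distinct maps are counted, not words). *)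

(* Defs.v *)
From HB Require Import structures.
From mathcomp Require Import all_boot all_order all_algebra.
From mathcomp Require Import all_classical all_reals all_analysis.

Set Implicit Arguments.
Unset Strict Implicit.
Unset Printing Implicit Defensive.

Import Order.TTheory GRing.Theory Num.Theory.
Import numFieldNormedType.Exports.

Local Open Scope classical_set_scope.
Local Open Scope card_scope.
Local Open Scope ring_scope.

(* The library's norm on 'rV[R]_d is the sup norm, whereas similitudes,
   distances and diameters are Euclidean.  Both norms induce the topology used
   in [compact] below. *)
Definition eucl_dist (R : realType) (d : nat) (a b : 'rV[R]_d) : R :=
  Num.sqrt (\sum_(i < d) (a ord0 i - b ord0 i) ^+ 2).

Definition set_dist (R : realType) (d : nat) (E F : set 'rV[R]_d) : R :=
  inf [set eucl_dist a b | a in E & b in F].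

(* Extended-real valued: +oo on unbounded sets (and -oo on the empty set). *)
Definition diameter (R : realType) (d : nat) (D : set 'rV[R]_d) : \bar R :=
  ereal_sup [set (eucl_dist a b)%:E | a in D & b in D].

Definition contractive_similitude (R : realType) (d : nat) (rho : R)
    (f : 'rV[R]_d -> 'rV[R]_d) : Prop :=
  0 < rho < 1 /\ forall a b, eucl_dist (f a) (f b) = rho * eucl_dist a b.

(* These conditions determine K uniquely when all the S j are contractions;
   they also force 0 < N, since the union is empty for N = 0. *)
Definition self_similar_set (R : realType) (d N : nat)
    (S : 'I_N -> 'rV[R]_d -> 'rV[R]_d) (K : set 'rV[R]_d) : Prop :=
  [/\ K !=set0, compact K & K = \bigcup_j (S j @` K)].

Definition word (N : nat) : Type := seq 'I_N.

(* S_{i_1 ... i_k} = S_{i_1} \o ... \o S_{i_k} *)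
Definition word_map (T : Type) (N : nat) (S : 'I_N -> T -> T)
    (x : word N) : T -> T :=
  foldr (fun i f => S i \o f) id x.

Definition word_ratio (R : realType) (N : nat) (rho : 'I_N -> R)
    (x : word N) : R :=
  \prod_(i <- x) rho i.

(* As every rho j is smaller than 1, the default value 1 plays no role as soon
   as 0 < N. *)
Definition min_ratio (R : realType) (N : nat) (rho : 'I_N -> R) : R :=
  \big[Num.min/1]_(j < N) rho j.

(* [level rho n x] states that x belongs to J_n, i.e. x is in X and |x| = n;
   the sets J_n are pairwise disjoint. *)
Definition level (R : realType) (N : nat) (rho : 'I_N -> R) (n : nat) :
    set (word N) :=
  if n is 0%N then [set [::]]
  else [set x | exists (y : word N) (i : 'I_N), x = rcons y i /\
          word_ratio rho x <= min_ratio rho ^+ n < word_ratio rho y].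

Definition tree_vertices (R : realType) (N : nat) (rho : 'I_N -> R) :
    set (word N) :=
  \bigcup_n level rho n.

(* y = x^{-1} *)
Definition parent (R : realType) (N : nat) (rho : 'I_N -> R)
    (x y : word N) : Prop :=
  exists n : nat, [/\ level rho n.+1 x, level rho n y & prefix y x].

Definition vertical_edge (R : realType) (N : nat) (rho : 'I_N -> R)
    (x y : word N) : Prop :=
  parent rho x y \/ parent rho y x.

Definition horizontal_edge (R : realType) (d N : nat)
    (S : 'I_N -> 'rV[R]_d -> 'rV[R]_d) (rho : 'I_N -> R)
    (K : set 'rV[R]_d) (kappa : R) (x y : word N) : Prop :=
  exists n : nat, [/\ level rho n x, level rho n y, x <> y &
    set_dist (word_map S x @` K) (word_map S y @` K)
      <= kappa * min_ratio rho ^+ n].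

Definition word_equiv (R : realType) (d N : nat)
    (S : 'I_N -> 'rV[R]_d -> 'rV[R]_d) (rho : 'I_N -> R)
    (x y : word N) : Prop :=
  exists n : nat,
    [/\ level rho n x, level rho n y & word_map S x = word_map S y].

Definition word_class (R : realType) (d N : nat)
    (S : 'I_N -> 'rV[R]_d -> 'rV[R]_d) (rho : 'I_N -> R)
    (x : word N) : set (word N) :=
  [set y | word_equiv S rho x y].

Definition quotient_vertices (R : realType) (d N : nat)
    (S : 'I_N -> 'rV[R]_d -> 'rV[R]_d) (rho : 'I_N -> R) :
    set (set (word N)) :=
  word_class S rho @` tree_vertices rho.

Definition induced_edge (T : Type) (e : T -> T -> Prop) (C D : set T) : Prop :=
  C <> D /\ exists x y, [/\ C x, D y & e x y].

Definition quotient_edge (R : realType) (d N : nat)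
    (S : 'I_N -> 'rV[R]_d -> 'rV[R]_d) (rho : 'I_N -> R)
    (K : set 'rV[R]_d) (kappa : R) (C D : set (word N)) : Prop :=
  induced_edge (vertical_edge rho) C D \/
  induced_edge (horizontal_edge S rho K kappa) C D.

(* For the graph with vertex set V and edge relation E. *)
Definition bounded_degree (T : Type) (V : set T) (E : T -> T -> Prop) : Prop :=
  exists M : nat, forall x, V x -> [set y | V y /\ E x y] #<= `I_M.

(* The counted elements are maps, not words. *)
Definition weak_separation_condition (R : realType) (d N : nat)
    (S : 'I_N -> 'rV[R]_d -> 'rV[R]_d) (rho : 'I_N -> R)
    (K : set 'rV[R]_d) : Prop :=
  forall c : R, 0 < c -> exists gamma : nat,
  forall (n : nat) (D : set 'rV[R]_d), (0 < n)%N ->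
    (diameter D <= (c * min_ratio rho ^+ n)%:E)%E ->
    [set word_map S x | x in
      [set x | level rho n x /\ (word_map S x @` K) `&` D !=set0]]
    #<= `I_gamma.

(* Main.v *)
Require Import Defs.
From mathcomp Require Import all_boot all_order all_algebra.
From mathcomp Require Import all_classical all_reals all_analysis.
From mathcomp Require Import lra.

(** Count, for a set D, the classes of level n whose cells meet D.
    If the degree is at most M and diam D <= kappa r^n, these classes are
    pairwise adjacent or equal, so there are at most M + 1 of them.  For
    diam D <= c r^n with a larger c, pass to parents: a cell meeting D lies in
    its parent's cell, which also meets D, and relative to the scale r^(n-1)
    the constant c has become c r; after finitely many steps it is below kappa.
    Conversely, the neighbours of a class x of level n have level n - 1, n or
    n + 1, and their cells all meet a neighbourhood of K_x of diameter
    O(r^n). *)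

Import Order.TTheory GRing.Theory Num.Theory.
Import numFieldNormedType.Exports.

Local Open Scope classical_set_scope.
Local Open Scope ring_scope.
Local Open Scope card_scope.

(** * Cardinality bounds by initial segments of the naturals *)

(** The empty set is a separate case because [T] may be empty, and then no function [nat -> T]
    exists. *)
Lemma card_le_IIP (T : Type) (A : set T) (n : nat) :
  A #<= `I_n <-> A = set0 \/ exists f : nat -> T, A `<=` f @` `I_n.
Proof.
split=> [/pfcard_geP[->|[f]]|[->|[f Af]]]; [by left| |exact: card_ge0|].
  by right; exists f; apply: (@surj _ _ _ _ f).
exact: card_le_trans (subset_card_le Af) (card_image_le _ _).
Qed.

Lemma card_le_II_setU (T : Type) (A B : set T) (m n : nat) :
  A #<= `I_m -> B #<= `I_n -> A `|` B #<= `I_(m + n).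
Proof.
move=> leA leB.
have [->|[f Af]] := (card_le_IIP _ _ _).1 leA.
  by rewrite set0U (card_le_trans leB)// card_le_II leq_addl.
have [->|[g Bg]] := (card_le_IIP _ _ _).1 leB.
  by rewrite setU0 (card_le_trans leA)// card_le_II leq_addr.
apply/card_le_IIP; right.
exists (fun i => if (i < m)%N then f i else g (i - m)%N) => t.
case=> [/Af[i /= im <-]|/Bg[i /= iin <-]].
  by exists i; rewrite /= ?im// ltn_addr.
exists (m + i)%N; first by rewrite /= ltn_add2l.
by rewrite ltnNge leq_addr /= addKn.
Qed.

Lemma card_le_II_bigcup (T U : Type) (A : set T) (F : T -> set U) (m n : nat) :
  A #<= `I_m -> (forall a, A a -> F a #<= `I_n) ->
  \bigcup_(a in A) F a #<= `I_(m * n).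
Proof.
move=> /card_le_IIP[->|[f Af] leF].
  by rewrite bigcup_set0 => _; exact: card_ge0.
(* Induction on the number [k] of enumerated indices; the intersection with [A] is kept since [f]
   may take values outside [A], where [F] is not controlled. *)
suff {Af} : forall k, \bigcup_(a in A `&` f @` `I_k) F a #<= `I_(k * n).
  by move=> /(_ m); rewrite (setIidl Af).
elim=> [|k IHk]; first by rewrite II0 image_set0 setI0 bigcup_set0 card_ge0.
have step : \bigcup_(a in A `&` f @` `I_k.+1) F a `<=`
    (\bigcup_(a in A `&` [set f k]) F a) `|` \bigcup_(a in A `&` f @` `I_k) F a.
  move=> u [a [Aa [i /= ik fia]] Fau].
  move: ik; rewrite ltnS leq_eqVlt => /orP[/eqP ik|ik].
    by left; exists a => //; split=> //=; rewrite -fia ik.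
  by right; exists a => //; split=> //; exists i.
rewrite mulSn; apply: card_le_trans (subset_card_le step) _.
apply: card_le_II_setU => //.
have [Afk|nAfk] := pselect (A (f k)).
  apply: card_le_trans (leF _ Afk).
  by apply: subset_card_le => u [a [_ ->]].
rewrite (_ : A `&` _ = set0) ?bigcup_set0 ?card_ge0//.
by apply/seteqP; split=> // a [Aa /= afk]; apply: nAfk; rewrite -afk.
Qed.

(** * Euclidean distance, diameter and distance of sets *)

Lemma eucl_dist_ge0 (R : realType) (d : nat) (a b : 'rV[R]_d) :
  0 <= eucl_dist a b.
Proof. exact: sqrtr_ge0. Qed.

Lemma eucl_distxx (R : realType) (d : nat) (a : 'rV[R]_d) : eucl_dist a a = 0.
Proof.
by rewrite /eucl_dist big1 ?sqrtr0// => i _; rewrite subrr expr0n.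
Qed.

Lemma eucl_distC (R : realType) (d : nat) (a b : 'rV[R]_d) :
  eucl_dist a b = eucl_dist b a.
Proof.
by congr Num.sqrt; apply: eq_bigr => i _; rewrite -opprB sqrrN.
Qed.

Lemma eucl_dist_sqr (R : realType) (d : nat) (a b : 'rV[R]_d) :
  eucl_dist a b ^+ 2 = \sum_(i < d) (a ord0 i - b ord0 i) ^+ 2.
Proof. by rewrite sqr_sqrtr// sumr_ge0// => i _; rewrite sqr_ge0. Qed.

(* The constant 2 avoids Minkowski's inequality; constants are irrelevant to
   the weak separation condition. *)
Lemma eucl_dist_quasi_triangle (R : realType) (d : nat) (b a c : 'rV[R]_d) :
  eucl_dist a c <= 2 * (eucl_dist a b + eucl_dist b c).
Proof.
have ab := eucl_dist_ge0 _ _ a b; have bc := eucl_dist_ge0 _ _ b c.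
rewrite -ler_sqr ?nnegrE ?eucl_dist_ge0 ?mulr_ge0 ?addr_ge0//.
apply: (@le_trans _ _ (2 * (eucl_dist a b ^+ 2 + eucl_dist b c ^+ 2))).
  rewrite !eucl_dist_sqr -big_split /= mulr_sumr; apply: ler_sum => i _.
  set x := a _ _; set y := b _ _; set z := c _ _.
  (* Parallelogram identity: this square is exactly the gap between the two sides. *)
  by have := sqr_ge0 (x + z - 2 * y); nra.
by nra.
Qed.

Lemma eucl_dist_bounded (R : realType) (d : nat) (K : set 'rV[R]_d) :
  compact K -> exists2 B : R,
    0 <= B & forall a b, K a -> K b -> eucl_dist a b <= B.
Proof.
move=> /compact_bounded/pinfty_ex_gt0[M M0 KM].
(* [M] bounds the sup norm on [K], so coordinates of differences are at most [2 * M] in absolute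
   value. *)
exists (Num.sqrt (\sum_(i < d) (2 * M) ^+ 2)); first exact: sqrtr_ge0.
move=> a b Ka Kb; apply: ler_wsqrtr; apply: ler_sum => i _.
have coord (x : 'rV[R]_d) : K x -> `|x ord0 i| <= M.
  move=> /KM /=; apply: le_trans.
  rewrite [leRHS]/Num.norm /= mx_normrE.
  by apply/bigmax_geP; right => /=; exists (ord0, i).
have := coord _ Ka; have := coord _ Kb; rewrite !ler_norml => /andP[? ?] /andP[? ?].
by nra.
Qed.

Lemma eucl_dist_le_diameter {R : realType} {d : nat} {D : set 'rV[R]_d} {c : R}
    (a b : 'rV[R]_d) :
  (diameter D <= c%:E)%E -> D a -> D b -> eucl_dist a b <= c.
Proof.
move=> Dc Da Db; rewrite -lee_fin; apply: le_trans Dc.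
by apply: ereal_sup_ubound; exists a => //; exists b.
Qed.

Lemma diameter_le (R : realType) (d : nat) (D : set 'rV[R]_d) (c : R) :
  (forall a b, D a -> D b -> eucl_dist a b <= c) -> (diameter D <= c%:E)%E.
Proof.
by move=> Dc; apply: ge_ereal_sup => _ [a Da [b Db <-]]; rewrite lee_fin Dc.
Qed.

Lemma set_dist_le (R : realType) (d : nat) (E F : set 'rV[R]_d) a b :
  E a -> F b -> set_dist E F <= eucl_dist a b.
Proof.
move=> Ea Fb; apply: ge_inf; last by exists a => //; exists b.
by exists 0 => _ [x _ [y _ <-]]; exact: eucl_dist_ge0.
Qed.

(** The inequality is strict because the infimum need not be attained. *)
Lemma set_dist_lt (R : realType) (d : nat) (E F : set 'rV[R]_d) (c : R) :
  E !=set0 -> F !=set0 -> set_dist E F < c ->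
  exists a b, [/\ E a, F b & eucl_dist a b < c].
Proof.
move=> [a Ea] [b Fb] /inf_lt[|_ [x Ex [y Fy <-]] xy].
  by exists (eucl_dist a b); exists a => //; exists b.
by exists x, y.
Qed.

Lemma word_map_cat (T : Type) (N : nat) (S : 'I_N -> T -> T) (x y : word N) :
  word_map S (x ++ y) = word_map S x \o word_map S y.
Proof. by elim: x => //= i x ->. Qed.

(** * Words, cells and levels *)

Section AugmentedTree.

Variables (R : realType) (d N : nat).
Variables (S : 'I_N -> 'rV[R]_d -> 'rV[R]_d) (rho : 'I_N -> R).
Variables (K : set 'rV[R]_d) (kappa : R).
Hypothesis hS : forall j : 'I_N, contractive_similitude (rho j) (S j).
Hypothesis hK : self_similar_set S K.

Local Notation r := (min_ratio rho).
Local Notation cell x := (word_map S x @` K).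

Lemma min_ratio_gt0 : 0 < r.
Proof.
by apply: lt_bigmin => // j _; have [/andP[]] := hS j.
Qed.

Lemma min_ratio_le j : r <= rho j.
Proof. exact: bigmin_le. Qed.

Lemma min_ratio_lt1 : r < 1.
Proof.
(* A point of [K] yields an index [j]; with no index the minimum would be its default value 1. *)
have [[a Ka] _ KE] := hK.
move: Ka; rewrite KE => -[j _ _].
by apply: le_lt_trans (min_ratio_le j) _; have [/andP[]] := hS j.
Qed.

Lemma word_ratio_rcons (y : word N) i :
  word_ratio rho (rcons y i) = word_ratio rho y * rho i.
Proof. by rewrite /word_ratio -cats1 big_cat big_seq1. Qed.

Lemma word_map_dist (x : word N) a b :
  eucl_dist (word_map S x a) (word_map S x b) = word_ratio rho x * eucl_dist a b.
Proof.
elim: x => [|i x IHx] /=; first by rewrite /word_ratio big_nil mul1r.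
by rewrite (hS i).2 IHx mulrA /word_ratio big_cons.
Qed.

Lemma cell_nonempty (x : word N) : cell x !=set0.
Proof. by have [[a Ka] _ _] := hK; exists (word_map S x a), a. Qed.

Lemma cell_subset (x : word N) : cell x `<=` K.
Proof.
have [_ _ KE] := hK.
elim: x => [|i x IHx] _ [a Ka <-] //=.
by rewrite KE; exists i => //; exists (word_map S x a) => //; apply: IHx; exists a.
Qed.

Lemma cell_prefix (x y : word N) : prefix y x -> cell x `<=` cell y.
Proof.
move=> /prefixP[z ->] _ [a Ka <-]; rewrite word_map_cat /=.
by exists (word_map S z a) => //; apply: (cell_subset z); exists a.
Qed.

(** The last letter multiplies a ratio still above [r ^+ n] by at least [r]. The resulting ratio
    windows are disjoint, which separates the levels. *)
Lemma level_word_ratio n (x : word N) :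
  level rho n x -> r ^+ n.+1 < word_ratio rho x <= r ^+ n.
Proof.
case: n => [->|n [y [i [-> /andP[-> lty]]]]].
  by rewrite /word_ratio big_nil expr1 expr0 min_ratio_lt1 lexx.
rewrite andbT word_ratio_rcons exprSr.
have r0 := min_ratio_gt0.
apply: (@lt_le_trans _ _ (word_ratio rho y * r)); first by rewrite ltr_pM2r.
rewrite ler_wpM2l ?min_ratio_le//.
by apply: ltW; apply: lt_trans lty; rewrite exprn_gt0.
Qed.

Lemma level_inj m n (x : word N) : level rho m x -> level rho n x -> m = n.
Proof.
suff le k l : level rho k x -> level rho l x -> (l <= k)%N.
  by move=> xm xn; apply/eqP; rewrite eqn_leq !le.
move=> /level_word_ratio/andP[lk _] /level_word_ratio/andP[_ ll].
have := lt_le_trans lk ll.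
by rewrite ltr_iXn2l ?min_ratio_gt0 ?min_ratio_lt1.
Qed.

Lemma level_parent n (x : word N) : level rho n.+1 x ->
  exists2 y, level rho n y & prefix y x.
Proof.
move=> xn; case: n xn => [_|n xn]; first by exists [::] => //; exact: prefix0s.
have r0 := min_ratio_gt0; have r1 := min_ratio_lt1.
(* The parent is the shortest prefix of ratio at most [r ^+ n.+1]. *)
pose P k := word_ratio rho (take k x) <= r ^+ n.+1.
have Px : P (size x).
  rewrite /P take_size; have /andP[_ /le_trans] := level_word_ratio _ _ xn.
  by apply; rewrite ler_iXn2l.
(* The minimal length is positive, as the empty word has ratio 1. *)
case: (ex_minnP (ex_intro P _ Px)) => -[|k] Pk min.
  by move: Pk; rewrite /P take0 /word_ratio big_nil leNgt exprn_ilt1 ?(ltW r0).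
have kx : (k < size x)%N by exact: min.
exists (take k.+1 x); last exact: prefix_take.
have [i0 _] : exists i : 'I_N, True by case: (x) kx => // i; exists i.
exists (take k x), (nth i0 x k); split; first exact: take_nth.
apply/andP; split=> //; rewrite ltNge; apply/negP => /min.
by rewrite ltnn.
Qed.

(** * Equivalence classes of words *)

Local Notation class := (word_class S rho).

Lemma word_classE n (x : word N) : level rho n x ->
  class x = [set z | level rho n z /\ word_map S z = word_map S x].
Proof.
move=> xn; apply/seteqP; split=> z /=.
  by move=> [m [/level_inj/(_ xn) <-]].
by move=> [zn zx]; exists n.
Qed.

Lemma mem_word_class n (x : word N) : level rho n x -> class x x.
Proof. by move=> xn; rewrite (word_classE _ _ xn). Qed.

Lemma word_class_eq n (x y : word N) : level rho n x -> class x y ->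
  [/\ level rho n y, word_map S y = word_map S x & class y = class x].
Proof.
move=> xn; rewrite {1}(word_classE _ _ xn) => -[yn yx]; split=> //.
by rewrite (word_classE _ _ xn) (word_classE _ _ yn) yx.
Qed.

Lemma vertex_class n (x : word N) :
  level rho n x -> quotient_vertices S rho (class x).
Proof. by move=> xn; exists x => //; exists n. Qed.

(** * Counting classes against counting maps *)

Definition classes_meeting n (D : set 'rV[R]_d) : set (set (word N)) :=
  class @` [set x | level rho n x /\ cell x `&` D !=set0].

Definition maps_meeting n (D : set 'rV[R]_d) : set ('rV[R]_d -> 'rV[R]_d) :=
  [set word_map S x | x in [set x | level rho n x /\ cell x `&` D !=set0]].

Lemma classes_meeting_card_le n D : classes_meeting n D #<= maps_meeting n D.
Proof.
pose F f := [set z : word N | level rho n z /\ word_map S z = f].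
apply: card_le_trans (subset_card_le _) (card_image_le F _).
move=> _ [x [xn xD] <-]; exists (word_map S x); first by exists x.
by rewrite (word_classE _ _ xn).
Qed.

Lemma maps_meeting_card_le n D : maps_meeting n D #<= classes_meeting n D.
Proof.
(* All members of a class have the same map, so an arbitrary one may be picked; the default [[::]]
   is not reached on nonempty classes. *)
pose F (C : set (word N)) := word_map S (xget [::] C).
apply: card_le_trans (subset_card_le _) (card_image_le F _).
move=> _ [x [xn xD] <-]; exists (class x); first by exists x.
have := xgetI [::] (mem_word_class _ _ xn).
by move=> /(word_class_eq _ _ _ xn)[].
Qed.

(** Level 0 is treated apart: it has no parents and lies outside the weak separation condition. *)
Lemma classes_meeting0 D : classes_meeting 0 D #<= `I_1.
Proof.
apply/card_le_IIP; right; exists (fun=> class [::]).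
by move=> _ [_ [-> _] <-]; exists 0%N.
Qed.

(** * From bounded degree to weak separation *)

Local Notation V := (quotient_vertices S rho).
Local Notation E := (quotient_edge S rho K kappa).

(** Induction on [k], the number of passages to parents that bring the constant down to [kappa]; [c]
    varies along the way. *)
Lemma bounded_degree_classes_meeting k c : c * r ^+ k <= kappa ->
  bounded_degree V E -> exists gamma : nat, forall n D,
    (diameter D <= (c * r ^+ n)%:E)%E -> classes_meeting n D #<= `I_gamma.
Proof.
move=> ck [M degM]; elim: k c ck => [|k IHk] c ck.
  (* One class meeting [D], plus its neighbours. *)
  exists (1 + M)%N => n D Dc.
  have [->|/set0P[_ [x [xn [a [xa Da]]] _]]] := eqVneq (classes_meeting n D) set0.
    exact: card_ge0.
  apply: (@card_le_trans _ _ _ ([set class x] `|` [set C | V C /\ E (class x) C])).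
    apply: subset_card_le => _ [y [yn [b [yb Db]]] <-].
    have [->|xy] := pselect (class y = class x); [by left|right].
    split; first exact: vertex_class yn.
    right; split; first exact/nesym.
    exists x, y; split; [exact: mem_word_class xn|exact: mem_word_class yn|].
    exists n; split=> //; first by move=> xyE; apply: xy; rewrite xyE.
    apply: le_trans (set_dist_le _ _ _ _ _ _ xa yb) _.
    apply: le_trans (eucl_dist_le_diameter _ _ Dc Da Db) _.
    by rewrite ler_wpM2r ?exprn_ge0 ?(ltW min_ratio_gt0)// -[c]mulr1.
  apply: card_le_II_setU; last exact/degM/(vertex_class _ _ xn).
  by apply/card_le_IIP; right; exists (fun=> class x) => _ ->; exists 0%N.
have [|gamma Hgamma] := IHk (c * r); first by rewrite -mulrA -exprS.
(* At most [gamma] parent classes with at most [M] neighbours each; the 1 covers level 0. *)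
exists (1 + gamma * M)%N => -[|n] D Dc.
  by apply: card_le_trans (classes_meeting0 D) _; rewrite card_le_II.
have {}/Hgamma leD : (diameter D <= (c * r * r ^+ n)%:E)%E.
  by rewrite -mulrA -exprS.
apply: (@card_le_trans _ _ _ (`I_(gamma * M))); last by rewrite card_le_II.
have leF C : classes_meeting n D C -> [set C' | V C' /\ E C C'] #<= `I_M.
  by move=> [x [xn _] <-]; exact/degM/(vertex_class _ _ xn).
apply: card_le_trans (card_le_II_bigcup _ _ _ _ _ _ leD leF).
apply: subset_card_le => _ [x [xn [a [xa Da]]] <-].
have [y yn yx] := level_parent _ _ xn.
exists (class y).
  by exists y => //; split=> //; exists a; split=> //; exact: cell_prefix yx _ xa.
split; first exact: vertex_class xn.
left; split; last first.
  exists y, x; split; [exact: mem_word_class yn|exact: mem_word_class xn|].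
  by right; exists n.
(* Equal classes would put [y] on both levels [n] and [n.+1]. *)
move=> yxE; have := mem_word_class _ _ yn.
rewrite yxE => /(word_class_eq _ _ _ xn)[/level_inj/(_ yn) nn _ _].
by elim: n nn {Dc leD leF xn yn} => // n IHn [].
Qed.

Lemma bounded_degree_weak_separation : 0 < kappa ->
  bounded_degree V E -> weak_separation_condition S rho K.
Proof.
move=> kappa0 deg c c0.
have [k ck] : exists k, c * r ^+ k <= kappa.
  have : (r ^+ n @[n --> \oo] --> (0 : R)).
    by apply: cvg_expr; rewrite gtr0_norm ?min_ratio_gt0 ?min_ratio_lt1.
  move=> /cvgrPdist_le /(_ (kappa / c)); rewrite divr_gt0// => /(_ isT)[k _ /(_ k)].
  rewrite /= => /(_ (leqnn _)).
  rewrite sub0r normrN ger0_norm ?exprn_ge0 ?(ltW min_ratio_gt0)// ler_pdivlMr//.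
  by exists k; rewrite mulrC.
have [gamma Hgamma] := bounded_degree_classes_meeting _ _ ck deg.
exists gamma => n D _ /Hgamma.
exact/card_le_trans/maps_meeting_card_le.
Qed.

(** * From weak separation to bounded degree *)

Lemma weak_separation_bounded_degree :
  weak_separation_condition S rho K -> bounded_degree V E.
Proof.
have [_ /eucl_dist_bounded[B B0 KB] _] := hK.
have r0 := min_ratio_gt0; have r1 := min_ratio_lt1.
(* Two uses of the quasi-triangle inequality bound the diameter of [D] below by [c0 * r ^+ n]. *)
pose c0 := 4 * B + 6 * (`|kappa| + 1).
have c0_gt0 : 0 < c0 by rewrite /c0; have := normr_ge0 kappa; lra.
(* Dividing by [r] lets the same constant serve level [n.+1]. *)
move=> /(_ (c0 / r)); rewrite divr_gt0// => /(_ isT)[gamma Hgamma].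
(* Three levels can contain neighbours; the successor makes the bound at least 1, as level 0
   requires. *)
exists (gamma.+1 * 3)%N => _ [x [n _ xn] <-].
(* The radius strictly exceeds [kappa * r ^+ n], so [set_dist_lt] places a point of every horizontal
   neighbour in [D]. *)
pose D := [set b | exists2 a, cell x a &
  eucl_dist a b <= (`|kappa| + 1) * r ^+ n].
have xD : cell x `<=` D.
  move=> a xa; exists a => //.
  by rewrite eucl_distxx mulr_ge0 ?addr_ge0 ?exprn_ge0 ?(ltW r0).
have leD m : (m <= n.+1)%N -> classes_meeting m D #<= `I_gamma.+1.
  case: m => [_|m mn].
    by apply: card_le_trans (classes_meeting0 D) _; rewrite card_le_II.
  apply: card_le_trans (classes_meeting_card_le _ _) _.
  apply: (@card_le_trans _ _ _ `I_gamma); last by rewrite card_le_II.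
  apply: Hgamma => //; apply: (@le_trans _ _ (c0 * r ^+ n)%:E); last first.
    rewrite lee_fin -mulrA ler_pM2l// exprS mulKf ?gt_eqF//.
    by rewrite ler_iXn2l.
  apply: diameter_le => b b' [_ [a Ka <-] ab] [_ [a' Ka' <-] ab'].
  have dist1 := eucl_dist_quasi_triangle _ _ (word_map S x a) b b'.
  have dist2 := eucl_dist_quasi_triangle _ _ (word_map S x a') (word_map S x a) b'.
  have distx : eucl_dist (word_map S x a) (word_map S x a') <= B * r ^+ n.
    rewrite word_map_dist mulrC ler_pM ?eucl_dist_ge0 ?KB//.
      by have /andP[/ltW + _] := level_word_ratio _ _ xn; apply/le_trans/exprn_ge0/ltW.
    by have /andP[] := level_word_ratio _ _ xn.
  move: dist1; rewrite (eucl_distC _ _ b (word_map S x a)) /c0.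
  by lra.
(* The indices 0, 1, 2 stand for children, horizontal neighbours and parents; for [n = 0] truncated
   subtraction merely repeats level 0. *)
have leF m : `I_3 m -> classes_meeting (n.+1 - m) D #<= `I_gamma.+1.
  by move=> _; apply: leD; exact: leq_subr.
rewrite mulnC.
apply: card_le_trans (card_le_II_bigcup _ _ _ _ _ _ (card_lexx _) leF).
apply: subset_card_le => _ [[y [m _ ym] <-] xy].
suff [x' [y' [i [xx' yy' i3 y'n [b [yb Db]]]]]] : exists x' y' i,
    [/\ class x x', class y y', (i < 3)%N, level rho (n.+1 - i) y' &
        cell y' `&` D !=set0].
  have [_ _ <-] := word_class_eq _ _ _ ym yy'.
  by exists i => //; exists y' => //; split=> //; exists b.
have [a xa] := cell_nonempty x.
case: xy => -[_ [x' [y' [xx' yy' edge]]]];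
  have [x'n Sx' _] := word_class_eq _ _ _ xn xx'; exists x', y'.
(* The cell of a parent contains that of [x'], which is the cell of [x]. *)
- case: edge => -[p [lev1 lev2 pre]].
    have np := level_inj _ _ _ x'n lev1.
    exists 2%N; split=> //; first by rewrite np subSS subn1.
    by exists a; split; [apply: cell_prefix pre _ _; rewrite Sx'|exact: xD].
  (* The cell of a child lies inside that of [x'], so any of its points is in [D]. *)
  have np := level_inj _ _ _ x'n lev2.
  exists 0%N; split=> //; first by rewrite np subn0.
  have [b yb] := cell_nonempty y'.
  by exists b; split=> //; apply: xD; rewrite -Sx'; exact: cell_prefix pre _ yb.
- case: edge => p [x'p y'p _ le_kappa].
  have np := level_inj _ _ _ x'n x'p.
  exists 1%N; split=> //; first by rewrite np subSS subn0.
  rewrite -np in le_kappa.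
  have [|a' [b [xa' yb /ltW ab]]] := set_dist_lt _ _ _ _ ((`|kappa| + 1) * r ^+ n)
      (cell_nonempty x') (cell_nonempty y').
    apply: le_lt_trans le_kappa _; rewrite ltr_pM2r ?exprn_gt0//.
    by have := ler_norm kappa; lra.
  by exists b; split=> //; exists a' => //; rewrite -Sx'.
Qed.

End AugmentedTree.

Theorem theorem1p5 (R : realType) (d N : nat)
    (S : 'I_N -> 'rV[R]_d -> 'rV[R]_d) (rho : 'I_N -> R)
    (K : set 'rV[R]_d) (kappa : R)
    (hS : forall j : 'I_N, contractive_similitude (rho j) (S j))
    (hK : self_similar_set S K)
    (hkappa : 0 < kappa) :
  bounded_degree (quotient_vertices S rho) (quotient_edge S rho K kappa)
  <-> weak_separation_condition S rho K.
Proof.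
split; first exact: bounded_degree_weak_separation.
exact: weak_separation_bounded_degree.
Qed.
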